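(* Let $\mathbb{F}$ be a field and let $q\in\mathbb{F}^*$ be not a root of unity. Let $m,n$ be positive integers with $\gcd(m,n)=1$, and let $f:\mathbb{Z}\to\mathbb{F}^*$ satisfy $f(i+n)=qf(i)$ for all $i\in\mathbb{Z}$. Then $\mathsf{V}^{m,n}_f$ is a weight representation of the quantum plane $\mathbb{F}_q[x,y]$ if and only if $m=n=1$.
   Context: $\mathbb{F}$ is a field of arbitrary characteristic, not necessarily algebraically closed, with group of units $\mathbb{F}^*$. The quantum plane is the unital associative algebra $\mathbb{F}_q[x,y]=\mathbb{F}\{x,y\}/(yx-qxy)$ with generators $x,y$ and relation $yx=qxy$. Representations are left modules. For positive integers $m,n$ and $f:\mathbb{Z}\to\mathbb{F}^*$ with $f(i+n)=qf(i)$ for all $i\in\mathbb{Z}$, $\mathsf{V}^{m,n}_f$ denotes the representation of $\mathbb{F}_q[x,y]$ on the space $\mathbb{F}[t^{\pm1}]$ of Laurent polynomials given by $x.t^i=t^{i+n}$, $y.t^i=f(i)t^{i-m}$ for all $i\in\mathbb{Z}$. A representation of $\mathbb{F}_q[x,y]$ is a weight representation if it is semisimple as a representation of the polynomial subalgebra $\mathbb{F}[H]$ generated by $H=xy$. *)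

(* Defs.v *)
From HB Require Import structures.
From mathcomp Require Import all_boot all_order all_algebra finmap.
From mathcomp Require Import boolp monalg.

Set Implicit Arguments.
Unset Strict Implicit.
Unset Printing Implicit Defensive.

Import GRing.Theory.
Local Open Scope ring_scope.
Local Open Scope quotient_scope.

(* The linear map {malg F[K]} -> V that sends the basis vector << k >> to
   h k. *)
Section LinearExtension.
Variables (F : fieldType) (K : choiceType) (V : lmodType F) (h : K -> V).

Definition linext (a : {malg F[K]}) : V := \sum_(k <- msupp a) a@_k *: h k.

Lemma linextEw (d : {fset K}) a :
  (msupp a `<=` d)%fset -> linext a = \sum_(k <- d) a@_k *: h k.
Proof.
move=> sd; rewrite /linext; apply: big_fset_incl => // k _ kNa.
by rewrite mcoeff_outdom // scale0r.
Qed.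

Lemma linext_is_linear : linear linext.
Proof.
move=> c a b.
pose d := (msupp a `|` msupp b `|` msupp (c *: a + b))%fset.
have sa : (msupp a `<=` d)%fset by rewrite /d -fsetUA fsubsetUl.
have sb : (msupp b `<=` d)%fset by rewrite /d fsetUAC fsubsetUr.
have sc : (msupp (c *: a + b) `<=` d)%fset by rewrite /d fsubsetUr.
rewrite (linextEw sa) (linextEw sb) (linextEw sc) scaler_sumr -big_split /=.
by apply: eq_bigr => k _; rewrite mcoeffD mcoeffZ scalerDl scalerA.
Qed.

HB.instance Definition _ :=
  GRing.isLinear.Build F {malg F[K]} V _ linext linext_is_linear.

Lemma linextU k : linext << k >> = h k.
Proof.
rewrite (linextEw (d := [fset k]%fset)) ?msuppU_le //.
by rewrite big_seq_fset1 mcoeffUU scale1r.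
Qed.

End LinearExtension.

Lemma malg_sumE (F : fieldType) (K : choiceType) (a : {malg F[K]}) :
  a = \sum_(k <- msupp a) a@_k *: << k >>.
Proof.
rewrite {1}(monalgE a); apply: eq_bigr => k _.
by apply/malgP => j; rewrite mcoeffZ !mcoeffU mulrnAr mulr1.
Qed.

Lemma malg_linear_ext (F : fieldType) (K : choiceType) (V : lmodType F)
    (L R : {linear {malg F[K]} -> V}) :
  (forall k, L << k >> = R << k >>) -> L =1 R.
Proof.
move=> LR a; rewrite (malg_sumE a) !linear_sum.
by apply: eq_bigr => k _; rewrite !linearZ /= LR.
Qed.

(* The quotient of an F-algebra A by the two-sided ideal generated by r; the
   ideal has to be proper because ring structures with units are nontrivial. *)
Section QuotientAlgebra.
Variables (F : fieldType) (A : algType F) (r : A).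

Definition ideal_gen (a : A) : Prop :=
  exists s : seq (A * A), a = \sum_(p <- s) p.1 * r * p.2.

Lemma ideal_gen0 : ideal_gen 0.
Proof. by exists [::]; rewrite big_nil. Qed.

Lemma ideal_gen_self : ideal_gen r.
Proof. by exists [:: (1, 1)]; rewrite big_seq1 mul1r mulr1. Qed.

Lemma ideal_genD a b : ideal_gen a -> ideal_gen b -> ideal_gen (a + b).
Proof. by case=> s -> [t ->]; exists (s ++ t); rewrite big_cat. Qed.

Lemma ideal_genMl c a : ideal_gen a -> ideal_gen (c * a).
Proof.
case=> s ->; exists [seq (c * p.1, p.2) | p <- s].
by rewrite big_map mulr_sumr; apply: eq_bigr => p _; rewrite /= !mulrA.
Qed.

Lemma ideal_genMr c a : ideal_gen a -> ideal_gen (a * c).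
Proof.
case=> s ->; exists [seq (p.1, p.2 * c) | p <- s].
by rewrite big_map mulr_suml; apply: eq_bigr => p _; rewrite /= !mulrA.
Qed.

Lemma ideal_genN a : ideal_gen a -> ideal_gen (- a).
Proof. by rewrite -mulN1r; apply: ideal_genMl. Qed.

Lemma ideal_genZ k a : ideal_gen a -> ideal_gen (k *: a).
Proof. by rewrite -mulr_algl; apply: ideal_genMl. Qed.

Definition ideal_equiv (a b : A) : bool := `[< ideal_gen (a - b) >].

Lemma ideal_equiv_is_equiv : equiv_class_of ideal_equiv.
Proof.
split=> [a|a b|b a c].
- by apply/asboolP; rewrite subrr; exact: ideal_gen0.
- by apply/asboolP/asboolP => /ideal_genN; rewrite opprB.
- move=> /asboolP ab /asboolP bc; apply/asboolP.
  by rewrite -(subrK b a) -addrA; exact: ideal_genD.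
Qed.
Canonical ideal_equiv_rel := EquivRelPack ideal_equiv_is_equiv.

Definition quot_alg (proper : ~ ideal_gen 1) : Type := {eq_quot ideal_equiv}.

Hypothesis proper : ~ ideal_gen 1.
Local Notation Q := (quot_alg proper).

HB.instance Definition _ := Choice.on Q.
HB.instance Definition _ := EqQuotient.on Q.

Definition qpi (a : A) : Q := \pi_Q a.
Definition qrepr (a : Q) : A := repr a.

Lemma qpiP a b : ideal_gen (a - b) <-> qpi a = qpi b.
Proof.
split=> [ab|/eqP]; first by apply/eqmodP/asboolP.
by move=> /eqP/eqmodP/asboolP.
Qed.

Lemma qreprK a : qpi (qrepr a) = a. Proof. exact: reprK. Qed.

Lemma qrepr_pi a : ideal_gen (qrepr (qpi a) - a).
Proof. by apply/qpiP; rewrite qreprK. Qed.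

Definition qopp (a : Q) : Q := qpi (- qrepr a).
Definition qadd (a b : Q) : Q := qpi (qrepr a + qrepr b).
Definition qmul (a b : Q) : Q := qpi (qrepr a * qrepr b).
Definition qscale (k : F) (a : Q) : Q := qpi (k *: qrepr a).

Lemma qoppE a : qopp (qpi a) = qpi (- a).
Proof. by apply/qpiP; rewrite -opprD; apply/ideal_genN/qrepr_pi. Qed.

Lemma qaddE a b : qadd (qpi a) (qpi b) = qpi (a + b).
Proof.
apply/qpiP; rewrite opprD addrACA.
by apply: ideal_genD; exact: qrepr_pi.
Qed.

Lemma qmulE a b : qmul (qpi a) (qpi b) = qpi (a * b).
Proof.
apply/qpiP.
set a' := qrepr _; set b' := qrepr _.
have -> : a' * b' - a * b = a' * (b' - b) + (a' - a) * b.
  by rewrite mulrBr mulrBl addrA subrK.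
apply: ideal_genD; [exact/ideal_genMl/qrepr_pi | exact/ideal_genMr/qrepr_pi].
Qed.

Lemma qscaleE k a : qscale k (qpi a) = qpi (k *: a).
Proof. by apply/qpiP; rewrite -scalerBr; apply/ideal_genZ/qrepr_pi. Qed.

Lemma quot_alg_ind (P : Q -> Prop) : (forall a, P (qpi a)) -> forall a, P a.
Proof. by move=> Pq a; rewrite -[a]qreprK. Qed.

Lemma qaddA : associative qadd.
Proof.
elim/quot_alg_ind=> a; elim/quot_alg_ind=> b; elim/quot_alg_ind=> c.
by rewrite !qaddE addrA.
Qed.
Lemma qaddC : commutative qadd.
Proof.
by elim/quot_alg_ind=> a; elim/quot_alg_ind=> b; rewrite !qaddE addrC.
Qed.
Lemma qadd0 : left_id (qpi 0) qadd.
Proof. by elim/quot_alg_ind=> a; rewrite qaddE add0r. Qed.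
Lemma qaddN : left_inverse (qpi 0) qopp qadd.
Proof. by elim/quot_alg_ind=> a; rewrite qoppE qaddE addNr. Qed.
HB.instance Definition _ :=
  GRing.isZmodule.Build Q qaddA qaddC qadd0 qaddN.

Lemma qpiD a b : qpi (a + b) = qpi a + qpi b.
Proof. exact/esym/qaddE. Qed.

Lemma qmulA : associative qmul.
Proof.
elim/quot_alg_ind=> a; elim/quot_alg_ind=> b; elim/quot_alg_ind=> c.
by rewrite !qmulE mulrA.
Qed.
Lemma qmul1 : left_id (qpi 1) qmul.
Proof. by elim/quot_alg_ind=> a; rewrite qmulE mul1r. Qed.
Lemma qmulr1 : right_id (qpi 1) qmul.
Proof. by elim/quot_alg_ind=> a; rewrite qmulE mulr1. Qed.
Lemma qmulDl : left_distributive qmul +%R.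
Proof.
elim/quot_alg_ind=> a; elim/quot_alg_ind=> b; elim/quot_alg_ind=> c.
by rewrite -qpiD !qmulE -qpiD mulrDl.
Qed.
Lemma qmulDr : right_distributive qmul +%R.
Proof.
elim/quot_alg_ind=> a; elim/quot_alg_ind=> b; elim/quot_alg_ind=> c.
by rewrite -qpiD !qmulE -qpiD mulrDr.
Qed.
Lemma qone_neq0 : qpi 1 != 0.
Proof. by apply/eqP => /qpiP; rewrite subr0. Qed.
HB.instance Definition _ := GRing.Zmodule_isNzRing.Build Q
  qmulA qmul1 qmulr1 qmulDl qmulDr qone_neq0.

Lemma qpiM a b : qpi (a * b) = qpi a * qpi b.
Proof. exact/esym/qmulE. Qed.

Lemma qpi1 : qpi 1 = 1. Proof. by []. Qed.

Lemma qscalerA k l a : qscale k (qscale l a) = qscale (k * l) a.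
Proof. by elim/quot_alg_ind: a => a; rewrite !qscaleE scalerA. Qed.
Lemma qscale1r : left_id 1 qscale.
Proof. by elim/quot_alg_ind=> a; rewrite qscaleE scale1r. Qed.
Lemma qscalerDr : right_distributive qscale +%R.
Proof.
move=> k; elim/quot_alg_ind=> a; elim/quot_alg_ind=> b.
by rewrite -qpiD !qscaleE -qpiD scalerDr.
Qed.
Lemma qscalerDl a : {morph qscale^~ a : k l / k + l}.
Proof.
move=> k l; elim/quot_alg_ind: a => a.
by rewrite !qscaleE -qpiD scalerDl.
Qed.
HB.instance Definition _ := GRing.Zmodule_isLmodule.Build F Q
  qscalerA qscale1r qscalerDr qscalerDl.

Lemma qpiZ k a : qpi (k *: a) = k *: qpi a.
Proof. exact/esym/qscaleE. Qed.

Lemma qscalerAl (k : F) (a b : Q) : k *: (a * b) = (k *: a) * b.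
Proof.
elim/quot_alg_ind: a => a; elim/quot_alg_ind: b => b.
by rewrite -qpiM -!qpiZ -qpiM scalerAl.
Qed.
HB.instance Definition _ := GRing.Lmodule_isLalgebra.Build F Q qscalerAl.

Lemma qscalerAr (k : F) (a b : Q) : k *: (a * b) = a * (k *: b).
Proof.
elim/quot_alg_ind: a => a; elim/quot_alg_ind: b => b.
by rewrite -qpiM -!qpiZ -qpiM scalerAr.
Qed.
HB.instance Definition _ := GRing.Lalgebra_isAlgebra.Build F Q qscalerAr.

End QuotientAlgebra.

Section QuantumPlane.
Variables (F : fieldType) (q : F).

(* F{x,y} is the monoid algebra of the free monoid on two letters. *)
Definition free_alg : Type := {malg F[{fmonom bool}]}.
HB.instance Definition _ := GRing.Lalgebra.on free_alg.

Lemma free_scalerAr (k : F) (a b : free_alg) : k *: (a * b) = a * (k *: b).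
Proof.
have kC (c : free_alg) : k%:MP * c = c * k%:MP.
  rewrite (monalgE c) mulr_sumr mulr_suml; apply: eq_bigr => w _.
  by rewrite /GRing.mul /= !fgmulUU mulrC mul1m mulm1.
by rewrite -!mul_malgC mulrA kC -mulrA.
Qed.
HB.instance Definition _ :=
  GRing.Lalgebra_isAlgebra.Build F free_alg free_scalerAr.

Definition free_x : free_alg := << fmu false >>.
Definition free_y : free_alg := << fmu true >>.
Definition qrel : free_alg := free_y * free_x - q *: (free_x * free_y).

(* The constant coefficient is an algebra morphism that vanishes on qrel. *)
Lemma free_counit : exists ev : free_alg -> F,
  [/\ ev 1 = 1, forall a b, ev (a * b) = ev a * ev b,
      forall (s : seq (free_alg * free_alg)) (G : _ -> free_alg),
        ev (\sum_(p <- s) G p) = \sum_(p <- s) ev (G p)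
    & ev qrel = 0].
Proof.
pose ev (a : free_alg) : F := a@_mone.
have evM a b : ev (a * b) = ev a * ev b.
  exact: (rmorphM (mcoeff (mone : {fmonom bool}))).
exists ev; split=> //; first by rewrite /ev mcoeff1 eqxx.
  by move=> s G; exact: (raddf_sum (mcoeff (mone : {fmonom bool}))).
have evx : ev free_x = 0 by rewrite /ev mcoeffU1 fm1_eq1.
have -> : ev qrel = ev (free_y * free_x) - q * ev (free_x * free_y).
  by rewrite /ev /qrel mcoeffB mcoeffZ.
have yx0 : ev (free_y * free_x) = 0 by rewrite evM evx mulr0.
have xy0 : ev (free_x * free_y) = 0 by rewrite evM evx mul0r.
apply: etrans (f_equal2 (fun s t => s - q * t) yx0 xy0) _.
by rewrite mulr0 subrr.
Qed.

Lemma qrel_proper : ~ ideal_gen qrel 1.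
Proof.
have [ev [ev1 evM ev_sum evr]] := free_counit.
case=> s /(congr1 ev); rewrite ev1 ev_sum big1.
  by move/eqP; rewrite oner_eq0.
by move=> p _; rewrite !evM evr mulr0 mul0r.
Qed.

Definition qplane : algType F := quot_alg qrel_proper.

Definition qx : qplane := qpi qrel_proper free_x.
Definition qy : qplane := qpi qrel_proper free_y.
Definition qH : qplane := qx * qy.

Lemma qplane_rel : qy * qx = q *: (qx * qy).
Proof.
transitivity (qpi qrel_proper (free_y * free_x)); first by rewrite qpiM.
transitivity (qpi qrel_proper (q *: (free_x * free_y))).
  by apply: (iffLR (qpiP _ _ _)); exact: ideal_gen_self.
by rewrite qpiZ qpiM.
Qed.

End QuantumPlane.

(* An F-space V with operators X and Y such that Y X = q X Y, viewed as a left
   module over the quantum plane, x acting as X and y as Y. *)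
Section Representation.
Variables (F : fieldType) (q : F) (V : lmodType F) (X Y : {linear V -> V}).

Definition word_act (w : {fmonom bool}) (v : V) : V :=
  foldr (fun b u => if b then Y u else X u) v w.

Definition free_act (a : free_alg F) (v : V) : V := linext (word_act^~ v) a.

Definition qrep (rel : forall v, Y (X v) = q *: X (Y v)) : Type := V.

Hypothesis rel : forall v, Y (X v) = q *: X (Y v).

Lemma word_act_linear w : linear (word_act w).
Proof.
move=> c u v; rewrite /word_act.
by elim: (fmonom_val w) => //= b s ->; case: b; rewrite linearP.
Qed.

Lemma free_act_linear_r a : linear (free_act a).
Proof.
move=> c u v; rewrite /free_act /linext scaler_sumr -big_split /=.
apply: eq_bigr => w _; rewrite word_act_linear scalerDr !scalerA.
by rewrite mulrC.
Qed.

Lemma free_act_linear_l v : linear (free_act^~ v).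
Proof. exact: linext_is_linear. Qed.

Lemma free_actDl v a b : free_act (a + b) v = free_act a v + free_act b v.
Proof. by rewrite /free_act raddfD. Qed.
Lemma free_actZl v k a : free_act (k *: a) v = k *: free_act a v.
Proof. by rewrite /free_act linearZ. Qed.
Lemma free_actBl v a b : free_act (a - b) v = free_act a v - free_act b v.
Proof. by rewrite /free_act raddfB. Qed.
Lemma free_act_suml v (I : Type) (s : seq I) (G : I -> free_alg F) :
  free_act (\sum_(i <- s) G i) v = \sum_(i <- s) free_act (G i) v.
Proof. by rewrite /free_act raddf_sum. Qed.
Lemma free_actDr a u v : free_act a (u + v) = free_act a u + free_act a v.
Proof. by have := free_act_linear_r a 1 u v; rewrite !scale1r. Qed.
Lemma free_act0r a : free_act a 0 = 0.
Proof. by apply: (addrI (free_act a 0)); rewrite -free_actDr !addr0. Qed.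
Lemma free_actZr a k v : free_act a (k *: v) = k *: free_act a v.
Proof. by have := free_act_linear_r a k v 0; rewrite free_act0r !addr0. Qed.
Lemma free_act_sumr a (I : Type) (s : seq I) (G : I -> V) :
  free_act a (\sum_(i <- s) G i) = \sum_(i <- s) free_act a (G i).
Proof. exact: (big_morph _ (free_actDr a) (free_act0r a)). Qed.

Lemma free_actU w v : free_act << w >> v = word_act w v.
Proof. exact: linextU. Qed.

Lemma free_actUc c w v : free_act << c *g w >> v = c *: word_act w v.
Proof.
rewrite /free_act (linextEw _ msuppU_le).
by rewrite big_seq_fset1 mcoeffUU.
Qed.

Lemma word_actZ w c v : word_act w (c *: v) = c *: word_act w v.
Proof. by rewrite -free_actU free_actZr free_actU. Qed.
Lemma word_act_sum w (I : Type) (s : seq I) (G : I -> V) :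
  word_act w (\sum_(i <- s) G i) = \sum_(i <- s) word_act w (G i).
Proof.
by rewrite -free_actU free_act_sumr; apply: eq_bigr => i _; rewrite free_actU.
Qed.

Lemma free_actM a b v : free_act (a * b) v = free_act a (free_act b v).
Proof.
have -> : a * b =
    \sum_(w <- msupp a) \sum_(u <- msupp b) << a@_w * b@_u *g mmul w u >>.
  exact: malgME.
rewrite free_act_suml [RHS]/free_act /linext; apply: eq_bigr => w _.
rewrite free_act_suml word_act_sum scaler_sumr; apply: eq_bigr => u _.
rewrite free_actUc word_actZ scalerA; congr (_ *: _).
by rewrite /word_act fmM foldr_cat.
Qed.

Lemma free_act1 v : free_act 1 v = v.
Proof. by rewrite [free_act _ _]free_actU /word_act fm1. Qed.

Lemma free_act_x v : free_act (free_x F) v = X v.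
Proof. by rewrite free_actU /word_act fmuE. Qed.
Lemma free_act_y v : free_act (free_y F) v = Y v.
Proof. by rewrite free_actU /word_act fmuE. Qed.

Lemma free_act_qrel v : free_act (qrel q) v = 0.
Proof.
have -> : free_act (qrel q) v =
    free_act (free_y F * free_x F) v - q *: free_act (free_x F * free_y F) v.
  by rewrite -free_actZl; exact: free_actBl.
have yx : free_act (free_y F * free_x F) v = Y (X v).
  by rewrite free_actM free_act_x free_act_y.
have xy : free_act (free_x F * free_y F) v = X (Y v).
  by rewrite free_actM free_act_y free_act_x.
apply: etrans (f_equal2 (fun s t => s - q *: t) yx xy) _.
by rewrite rel subrr.
Qed.

Lemma free_act_ideal a v : ideal_gen (qrel q) a -> free_act a v = 0.
Proof.
case=> s ->; rewrite free_act_suml big1 // => p _.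
by rewrite !free_actM free_act_qrel free_act0r.
Qed.

Definition qact (a : qplane q) (v : V) : V := free_act (qrepr a) v.

Lemma qact_pi a v : qact (qpi (@qrel_proper F q) a) v = free_act a v.
Proof.
apply/eqP; rewrite -subr_eq0 /qact -free_actBl.
by rewrite free_act_ideal //; exact: qrepr_pi.
Qed.

Lemma qactA a b v : qact a (qact b v) = qact (a * b) v.
Proof.
elim/quot_alg_ind: a => a; elim/quot_alg_ind: b => b.
by rewrite -qpiM !qact_pi free_actM.
Qed.
Lemma qact1 : left_id 1 qact.
Proof. by move=> v; rewrite qact_pi free_act1. Qed.
Lemma qactDr : right_distributive qact +%R.
Proof. by move=> a u v; rewrite /qact free_actDr. Qed.
Lemma qactDl v : {morph qact^~ v : a b / a + b}.
Proof.
elim/quot_alg_ind=> a; elim/quot_alg_ind=> b.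
by rewrite -qpiD !qact_pi free_actDl.
Qed.

HB.instance Definition _ := GRing.Zmodule.on (qrep rel).
HB.instance Definition _ :=
  GRing.Zmodule_isLmodule.Build (qplane q) (qrep rel) qactA qact1 qactDr qactDl.

Lemma qrep_x (v : qrep rel) : qx q *: v = X v.
Proof. by rewrite -free_act_x -qact_pi. Qed.
Lemma qrep_y (v : qrep rel) : qy q *: v = Y v.
Proof. by rewrite -free_act_y -qact_pi. Qed.
(* The action of F inherited from the quantum plane is the original one. *)
Lemma qrep_scalar (k : F) (v : qrep rel) : (k%:A : qplane q) *: v = k *: (v : V).
Proof.
rewrite -[RHS]/(k *: v) -{2}(free_act1 v) -free_actZl -qact_pi.
by rewrite qpiZ.
Qed.

End Representation.

(* The space F[t, t^-1] of Laurent polynomials; << i >> is t^i. *)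
Notation laurent F := {malg F[int]}.

Section VRep.
Variables (F : fieldType) (q : F) (m n : nat) (f : int -> F).

Definition Vx : {linear laurent F -> laurent F} :=
  linext (fun i => << i + n%:Z >> : laurent F).
Definition Vy : {linear laurent F -> laurent F} :=
  linext (fun i => f i *: (<< i - m%:Z >> : laurent F)).

Hypothesis hf : forall i, f (i + n%:Z) = q * f i.

Lemma Vrel v : Vy (Vx v) = q *: Vx (Vy v).
Proof.
pose L := Vy \o Vx : {linear laurent F -> laurent F}.
pose R := q \*: (Vx \o Vy) : {linear laurent F -> laurent F}.
suff LR i : L << i >> = R << i >>.
  exact: (malg_linear_ext LR v).
have Vxi j : Vx << j >> = << j + n%:Z >> by exact: linextU.
have Vyi j : Vy << j >> = f j *: (<< j - m%:Z >> : laurent F) by exact: linextU.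
rewrite -[LHS]/(Vy (Vx _)) -[RHS]/(q *: Vx (Vy _)) Vxi !Vyi linearZ Vxi hf.
by rewrite scalerA addrAC.
Qed.

Definition Vrep : lmodType (qplane q) := qrep Vrel.

Lemma Vrep_x i : qx q *: (<< i >> : Vrep) = << i + n%:Z >>.
Proof. by rewrite qrep_x /= linextU. Qed.
Lemma Vrep_y i : qy q *: (<< i >> : Vrep) = f i *: (<< i - m%:Z >> : laurent F).
Proof. by rewrite qrep_y /= linextU. Qed.

End VRep.

(* Modules over a subring B of R, for a left R-module M: submodules, simple
   submodules, and M being a direct sum of simple submodules. *)
Section Semisimple.
Variables (R : pzRingType) (M : lmodType R) (B : R -> Prop).

Definition submodule (W : M -> Prop) : Prop :=
  [/\ W 0, forall u v, W u -> W v -> W (u + v)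
    & forall b v, B b -> W v -> W (b *: v)].

Definition simple_submodule (W : M -> Prop) : Prop :=
  [/\ submodule W, exists2 w, W w & w != 0
    & forall U : M -> Prop, submodule U -> (forall u, U u -> W u) ->
        (forall u, U u -> u = 0) \/ (forall w, W w -> U w)].

Definition direct_sum (I : eqType) (W : I -> M -> Prop) : Prop :=
  (forall v, exists (s : seq I) (w : I -> M),
     [/\ uniq s, forall i, W i (w i) & v = \sum_(i <- s) w i]) /\
  (forall (s : seq I) (w : I -> M), uniq s -> (forall i, W i (w i)) ->
     \sum_(i <- s) w i = 0 -> forall i, i \in s -> w i = 0).

Definition semisimple : Prop :=
  exists (I : eqType) (W : I -> M -> Prop),
    (forall i, simple_submodule (W i)) /\ direct_sum W.

End Semisimple.

Definition polynomial_subalgebra (F : fieldType) (A : algType F) (h : A) :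
  A -> Prop := fun a => exists p : {poly F}, a = horner_alg h p.

Definition weight_representation (F : fieldType) (q : F)
  (M : lmodType (qplane q)) : Prop :=
  semisimple M (polynomial_subalgebra (qH q)).

(* Main.v *)
Require Import Defs.
From mathcomp Require Import all_boot all_order all_algebra.
From mathcomp Require Import finmap boolp monalg.

Set Implicit Arguments.
Unset Strict Implicit.
Unset Printing Implicit Defensive.

Import Order.TTheory GRing.Theory Num.Theory.
Local Open Scope ring_scope.

(** The element H = xy acts by H.t^i = f(i) t^(i + d) with d = n - m, so it is
    a weighted shift of the Laurent polynomials by d, with nonzero weights.

    If m = n = 1 then d = 0, every t^i is an eigenvector of H, and the
    Laurent polynomials are the direct sum of the lines F t^i
    (semisimple_monomial_lines).

    If d is nonzero, no simple F[H]-submodule exists (no_simple_submodule).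
    Suppose W is simple and w is a nonzero vector of W. Since H is injective,
    H F[H] w is a nonzero submodule of W, so it contains w. But H shifts all
    exponents by d in one direction, so the extremal exponent of w on the
    opposite side occurs in no vector of H F[H] w. A semisimple module without
    simple submodules is zero, whereas the Laurent polynomials are not; hence
    a weight representation has m = n, and coprimality then gives m = n = 1. *)

(** Being an F[h]-submodule only has to be tested on the scalars and on h,
    since F[h] is spanned by the powers of h. *)
Lemma submodule_polynomial_subalgebra (F : fieldType) (A : algType F)
    (M : lmodType A) (h : A) (W : M -> Prop) :
  W 0 -> (forall u v, W u -> W v -> W (u + v)) ->
  (forall (k : F) v, W v -> W ((k%:A : A) *: v)) ->
  (forall v, W v -> W (h *: v)) ->
  submodule (polynomial_subalgebra h) W.
Proof.
move=> W0 WD Wk Wh; split=> // _ v [p ->].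
elim/poly_ind: p v => [|p c IHp] v Wv; first by rewrite rmorph0 scale0r.
rewrite rmorphD rmorphM /= horner_algX horner_algC scalerDl -scalerA.
by apply: WD; [exact/IHp/Wh | exact: Wk].
Qed.

Section PolynomialSubalgebra.
Variables (F : fieldType) (A : algType F) (M : lmodType A) (h : A).
Implicit Types (W : M -> Prop) (v w : M).
Local Notation Fh := (polynomial_subalgebra h).

Lemma submodule_scalar W (k : F) v :
  submodule Fh W -> W v -> W ((k%:A : A) *: v).
Proof.
by case=> _ _ WB Wv; apply: WB Wv; exists k%:P; rewrite horner_algC.
Qed.

Lemma submodule_shifted_cyclic w :
  submodule Fh (fun v => exists p : {poly F}, v = horner_alg h ('X * p) *: w).
Proof.
split=> [|_ _ [p ->] [r ->]|_ _ [p ->] [r ->]].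
- by exists 0; rewrite mulr0 rmorph0 scale0r.
- by exists (p + r); rewrite mulrDr rmorphD scalerDl.
- by exists (p * r); rewrite scalerA -rmorphM mulrCA.
Qed.

(** On a simple F[h]-module, h acts either by zero or invertibly: h F[h] w is
    a submodule, so it is zero or contains w. *)
Lemma simple_submodule_fixed W w :
  simple_submodule Fh W -> W w -> h *: w != 0 ->
  exists p : {poly F}, w = h *: (horner_alg h p *: w).
Proof.
case=> -[W0 WD WB] _ Wmin Ww hw_neq0.
have [|U0|UW] := Wmin _ (submodule_shifted_cyclic w).
- by move=> _ [p ->]; apply: WB Ww; exists ('X * p).
- case/eqP: hw_neq0; apply: U0; exists 1.
  by rewrite mulr1 horner_algX.
- have [p wE] := UW _ Ww; exists p.
  by rewrite {1}wE rmorphM /= horner_algX scalerA.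
Qed.

End PolynomialSubalgebra.

Lemma mcoeff_linext_monomial (F : fieldType) (K : choiceType)
    (c : K -> F) (s : K -> K) (a : {malg F[K]}) (k : K) :
  injective s ->
  (linext (fun j => c j *: (<< s j >> : {malg F[K]})) a)@_(s k) = c k * a@_k.
Proof.
move=> s_inj; rewrite /linext raddf_sum /=.
have term j : (a@_j *: (c j *: (<< s j >> : {malg F[K]})))@_(s k)
    = if j == k then c k * a@_k else 0.
  rewrite !mcoeffZ mcoeffU (inj_eq s_inj).
  by case: eqP => [->|_]; rewrite ?mulr1 ?mulr0 // mulrC.
rewrite (eq_bigr _ (fun j _ => term j)).
have [ka|kNa] := boolP (k \in msupp a).
  rewrite (bigD1_seq k) ?fset_uniq //= eqxx big1 ?addr0 // => j.
  by move=> /negPf ->.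
by rewrite (mcoeff_outdom kNa) mulr0 big1 // => j _; case: ifP.
Qed.

Section VRepH.
Variables (F : fieldType) (q : F) (m n : nat) (f : int -> F).
Hypothesis f_neq0 : forall i, f i != 0.
Hypothesis f_qper : forall i, f (i + n%:Z) = q * f i.

Local Notation V := (Vrep m f_qper).
Local Notation d := (n%:Z - m%:Z).
Local Notation coef v i := ((v : laurent F)@_i).
Local Notation FH := (polynomial_subalgebra (qH q)).

Lemma Vrep_HE (v : V) :
  qH q *: v = linext (fun i => f i *: (<< i + d >> : laurent F)) v.
Proof.
rewrite /qH -scalerA qrep_y qrep_x.
pose L := Vx F n \o Vy m f : {linear laurent F -> laurent F}.
apply: (malg_linear_ext (L := L)) => i; rewrite /= !linextU linearZ /= linextU.
by rewrite -addrA [- _ + _]addrC.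
Qed.

Lemma coef_H (v : V) (i : int) : coef (qH q *: v) (i + d) = f i * coef v i.
Proof.
rewrite Vrep_HE (@mcoeff_linext_monomial _ _ f (+%R^~ d)) //.
exact: addIr.
Qed.

Lemma Vrep_H_neq0 (v : V) : v != 0 -> qH q *: v != 0.
Proof.
apply: contra => /eqP Hv0; apply/eqP/malgP => i; rewrite mcoeff0.
have := coef_H v i; rewrite Hv0 mcoeff0 => /esym/eqP.
by rewrite mulf_eq0 (negPf (f_neq0 i)) => /eqP.
Qed.

(** Multiplying exponents by d makes H raise them whatever the sign of d:
    i * d becomes i * d + d ^ 2. *)
Definition vanishes_below (c : int) (v : V) : Prop :=
  forall i, i * d < c -> coef v i = 0.

Lemma vanishes_below_H (c : int) (v : V) :
  vanishes_below c v -> vanishes_below (c + d * d) (qH q *: v).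
Proof.
move=> vc i ic; rewrite -(subrK d i) coef_H vc ?mulr0 //.
by rewrite mulrBl ltrBlDr.
Qed.

Lemma submodule_vanishes_below (c : int) : submodule FH (vanishes_below c).
Proof.
apply: submodule_polynomial_subalgebra.
- by move=> i _; rewrite mcoeff0.
- by move=> u v uc vc i ic; rewrite mcoeffD uc // vc // addr0.
- by move=> k v vc i ic; rewrite qrep_scalar mcoeffZ vc // mulr0.
- move=> v vc i ic; apply: (vanishes_below_H vc).
  by rewrite (lt_le_trans ic) // lerDl -expr2 sqr_ge0.
Qed.

Lemma exists_lowest_coef (v : V) :
  v != 0 -> exists2 i, coef v i != 0 & vanishes_below (i * d) v.
Proof.
move=> v_neq0.
have [i0 i0v] : exists i, i \in msupp (v : laurent F).
  apply/fset0Pn; apply: contra v_neq0 => /eqP v0.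
  by rewrite [v](malg_sumE (v : laurent F)) v0 big_seq_fset0.
pose i := [arg min_(i < [` i0v]%fset) (val i * d)%R]%O.
exists (val i); first by rewrite mcoeff_neq0; exact: fsvalP.
rewrite /i; case: arg_minP => //= j _ jmin k kj.
apply: mcoeff_outdom; apply/negP => kv.
by have := jmin [` kv]%fset isT; rewrite leNgt kj.
Qed.

(** Simplicity would put w in H F[H] w; but the exponent of the lowest
    coefficient of w, in the ordering by i * d, has coefficient zero in
    every vector of H F[H] w. *)
Lemma no_simple_submodule (W : V -> Prop) :
  d != 0 -> ~ simple_submodule FH W.
Proof.
move=> d_neq0 simpleW; have [_ [w Ww w_neq0] _] := simpleW.
have [p wE] := simple_submodule_fixed simpleW Ww (Vrep_H_neq0 w_neq0).
have [i wi_neq0 wlow] := exists_lowest_coef w_neq0.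
case/eqP: wi_neq0; rewrite wE.
have [_ _ stable] := submodule_vanishes_below (i * d).
have pw_low : vanishes_below (i * d) (horner_alg (qH q) p *: w).
  by apply: stable wlow; exists p.
by apply: (vanishes_below_H pw_low); rewrite ltrDl -expr2 exprn_even_gt0.
Qed.

Lemma shift_not_semisimple : d != 0 -> ~ semisimple V FH.
Proof.
move=> d_neq0 [I [W [simpleW [spanW _]]]].
have [s [w [_ _ tE]]] := spanW (<< 0 >> : laurent F).
case: s tE => [|i s _]; last exact: (no_simple_submodule d_neq0 (simpleW i)).
rewrite big_nil => /malgP/(_ 0)/eqP.
by rewrite mcoeffUU mcoeff0 oner_eq0.
Qed.

Definition monomial_line (i : int) (v : V) : Prop :=
  exists c : F, v = c *: (<< i >> : laurent F).

Lemma simple_monomial_line (i : int) :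
  d = 0 -> simple_submodule FH (monomial_line i).
Proof.
move=> d0; split.
- apply: submodule_polynomial_subalgebra.
  + by exists 0; rewrite scale0r.
  + by move=> _ _ [a ->] [b ->]; exists (a + b); rewrite scalerDl.
  + by move=> k _ [a ->]; exists (k * a); rewrite qrep_scalar scalerA.
  + move=> _ [a ->]; exists (a * f i).
    by rewrite Vrep_HE linearZ /= linextU d0 addr0 scalerA.
- exists (<< i >> : laurent F); first by exists 1; rewrite scale1r.
  by apply/eqP => /malgP/(_ i)/eqP; rewrite mcoeffUU mcoeff0 oner_eq0.
- move=> U subU Ui; have [U0|] := pselect (forall u, U u -> u = 0).
    by left.
  move=> /existsNP[u /not_implyP[Uu /eqP u_neq0]]; right=> _ [b ->].
  have [a uE] := Ui _ Uu; have a_neq0 : a != 0.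
    by apply: contra u_neq0 => /eqP a0; rewrite uE a0 scale0r.
  have := submodule_scalar (b / a) subU Uu.
  by rewrite qrep_scalar uE scalerA divfK.
Qed.

Lemma semisimple_monomial_lines : d = 0 -> semisimple V FH.
Proof.
move=> d0; exists int, monomial_line; split.
  by move=> i; exact: simple_monomial_line.
split=> [v|s w s_uniq ws sum0 i i_s].
  exists (msupp (v : laurent F)), (fun i => coef v i *: (<< i >> : laurent F)).
  by split; [exact: fset_uniq | move=> i; exists (coef v i) | exact: malg_sumE].
have [c wE] := ws i.
have coef_sum : coef (\sum_(j <- s) w j) i = c.
  rewrite (raddf_sum (mcoeff i)) (bigD1_seq i) //= big1 ?addr0.
    by rewrite wE mcoeffZ mcoeffUU mulr1.
  move=> j /negPf ji; have [b ->] := ws j.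
  by rewrite mcoeffZ mcoeffU ji mulr0.
by rewrite wE -coef_sum sum0 mcoeff0 scale0r.
Qed.

End VRepH.

Theorem proposition2p7 (F : fieldType) (q : F) (q_neq0 : q != 0)
    (q_not_root_of_unity : forall k : nat, (0 < k)%N -> q ^+ k != 1)
    (m n : nat) (m_gt0 : (0 < m)%N) (n_gt0 : (0 < n)%N)
    (coprime_mn : gcdn m n = 1%N)
    (f : int -> F) (f_neq0 : forall i : int, f i != 0)
    (f_quasiperiodic : forall i : int, f (i + n%:Z) = q * f i) :
  weight_representation (Vrep m f_quasiperiodic) <-> (m = 1%N /\ n = 1%N).
Proof.
split=> [weightV|[m1 n1]]; last first.
  by apply: semisimple_monomial_lines; rewrite m1 n1 subrr.
have : n%:Z - m%:Z == 0.
  by apply/negPn/negP => d_neq0; apply: shift_not_semisimple weightV.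
rewrite subr_eq0 => /eqP[nm].
by move: coprime_mn; rewrite nm gcdnn.
Qed.
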